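(* Consider the Super-Universal Newton Method (described in the context) with parameters $\alpha\in[\tfrac23,1]$ and $H_0>0$. Assume that $M_q<+\infty$ for some $q\in[2,4]$ and $H_0\le\mathcal H_\alpha(g_0)$. Let, for the iterates $\{x_i\}_{i=0}^{k-1}$ of the method with some $k\ge1$, $g_i=\|F'(x_i)\|_*>0$. Then $$H_{i+1}\le\mathcal H_\alpha(g_i),\qquad 0\le i\le k-1.$$ Moreover, the total number $N_k$ of oracle calls during the first $k$ iterations is bounded as follows: $$N_k\le 2k+\frac12\log_2\frac{\mathcal H_\alpha(g_{k-1})}{H_0}.$$
   Context: Spaces and norms. $\mathbb E$ is a finite-dimensional real vector space, $\mathbb E^*$ its dual, $\langle s,x\rangle$ the value of $s\in\mathbb E^*$ at $x\in\mathbb E$. $B:\mathbb E\to\mathbb E^*$ is a fixed self-adjoint positive-definite linear operator; $\|x\|=\langle Bx,x\rangle^{1/2}$ on $\mathbb E$ and $\|s\|_*=\langle s,B^{-1}s\rangle^{1/2}$ on $\mathbb E^*$. Norms of symmetric multilinear forms are induced: $\|\nabla^pf(x)\|=\max\{\nabla^pf(x)[h_1,\dots,h_p]:\ \|h_i\|\le1\}$. Notation: $\nabla^2 f(x)[h]^2=\langle\nabla^2f(x)h,h\rangle$. Problem. $\min_{x\in\operatorname{dom}\psi}\{F(x)=f(x)+\psi(x)\}$, where $f:\mathbb E\to\mathbb R$ is convex and several times differentiable and $\psi:\mathbb E\to\mathbb R\cup\{+\infty\}$ is a proper closed convex function. Smoothness constants. $L_{p,\nu}=\sup_{x\ne y}\|\nabla^pf(x)-\nabla^pf(y)\|/\|x-y\|^\nu$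 for $p\in\{2,3\}$, $\nu\in[0,1]$ (equal to $+\infty$ if the supremum is infinite or $\nabla^pf$ does not exist). For $2\le q\le4$: $M_{2+\nu}=L_{2,\nu}$ for $\nu\in[0,1)$ and $M_{3+\nu}=L_{3,\nu}$ for $\nu\in[0,1]$. Function $\mathcal H_\alpha$. For $t>0$, $\mathcal H_\alpha(t)=\inf_{2\le q\le4}(6M_q)^{\frac1{q-1}}\bigl(\tfrac1t\bigr)^{\alpha-\frac{q-2}{q-1}}$. Super-Universal Newton Method. Input: $x_0\in\operatorname{dom}\psi$, $\psi'(x_0)\in\partial\psi(x_0)$, arbitrary $\alpha\in[\frac23,1]$, $H_0>0$. For $k=0,1,\dots$: set $F'(x_k)=\nabla f(x_k)+\psi'(x_k)$ and $g_k=\|F'(x_k)\|_*$. For $j_k=0,1,2,\dots$ put $\lambda_k=4^{j_k}H_kg_k^\alpha$, $x_+=\operatorname{argmin}_x\{\langle\nabla f(x_k),x-x_k\rangle+\frac12\nabla^2f(x_k)[x-x_k]^2+\frac{\lambda_k}2\|x-x_k\|^2+\psi(x)\}$, $\psi'(x_+)=-\nabla f(x_k)-\nabla^2f(x_k)(x_+-x_k)-\lambda_kB(x_+-x_k)\in\partial\psi(x_+)$, $F'(x_+)=\nabla f(x_+)+\psi'(x_+)$, stopping at the first $j_k$ for which $\langle F'(x_+),x_k-x_+\rangle\ge\frac{1}{4\lambda_k}\|F'(x_+)\|_*^2$. Then set $x_{k+1}=x_+$ (with the corresponding $\psi'(x_{k+1})$) and $H_{k+1}=4^{j_k}H_k/4$.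 The number of oracle calls counts trial points: with $j_i$ denoting the final (accepted) inner index at iteration $i$, $N_k=\sum_{i=0}^{k-1}(1+j_i)$. *)

(* Defs.v *)
From HB Require Import structures.
From mathcomp Require Import all_boot all_order all_algebra.
From mathcomp Require Import all_classical all_reals all_analysis.

Set Implicit Arguments.
Unset Strict Implicit.
Unset Printing Implicit Defensive.

Import Order.TTheory GRing.Theory Num.Theory.
Import numFieldNormedType.Exports.

Local Open Scope classical_set_scope.
Local Open Scope ring_scope.

(* Finite-dimensional real normed spaces.  The norm of the structure serves only
   to provide the topology (all norms on such a space are equivalent, hence give
   the same differentials and the same closed sets); the Euclidean norm induced
   by the operator B is [enorm] below, and the two need not coincide. *)
#[short(type="normedVectType")]
HB.structure Definition NormedVector (R : realType) :=
  { E of Vector R E & NormedModule R E }.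

Section Norms.
Variables (R : realType) (E : normedVectType R).
Implicit Types (B : 'Hom(E, 'Hom(E, R^o))) (x : E) (s : 'Hom(E, R^o)).

Definition self_adjoint B : Prop := forall x y : E, B x y = B y x.

Definition positive_definite B : Prop := forall x : E, x != 0 -> 0 < B x x.

Definition enorm B x : R := Num.sqrt (B x x).

(* [(B^-1)%VF] is in general only a right inverse of B on its image; it is the
   two-sided inverse when B is positive definite, since then B is injective and
   E and its dual have the same dimension. *)
Definition dnorm B s : R := Num.sqrt (s ((B^-1)%VF s)).

(* For a p-linear form the supremum is a finite maximum; extended real values
   avoid relying on the default value of [sup]. *)
Definition form_norm B p (A : p.-tuple E -> R) : \bar R :=
  ereal_sup [set (A h)%:E | h in
    [set h : p.-tuple E | forall i, enorm B (tnth h i) <= 1]].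

End Norms.

Section Derivatives.
Variables (R : realType) (E : normedVectType R).
Implicit Types (f : E -> R^o) (x h : E).

(* [nabla f [:: h1; ..; hp] x] is the p-th derivative of f at x evaluated at
   h1, .., hp. *)
Fixpoint nabla f (hs : seq E) : E -> R^o :=
  if hs is h :: hs' then fun x => 'd (nabla f hs') x h else f.

(* Since E is finite-dimensional, a map into a space of multilinear forms is
   Frechet differentiable iff its evaluations at all fixed arguments are. *)
Definition ntimes_differentiable p f : Prop :=
  forall hs : seq E, (size hs < p)%N -> forall x, differentiable (nabla f hs) x.

Definition gradient f x : 'Hom(E, R^o) := linfun (fun v => nabla f [:: v] x).

Definition hessian f x h : 'Hom(E, R^o) :=
  linfun (fun v => nabla f [:: h; v] x).

Definition holder_const (B : 'Hom(E, 'Hom(E, R^o))) f (p : nat) (nu : R) :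
    \bar R :=
  if `[< ntimes_differentiable p f >] then
    ereal_sup
      [set (form_norm B (fun h : p.-tuple E =>
               (nabla f h z.1 - nabla f h z.2)%R)
             * ((enorm B (z.1 - z.2)%R `^ nu)^-1)%:E)%E
      | z in [set z : E * E | z.1 != z.2]]
  else +oo%E.

(* M_q; at q = 3 the constant is L_{3,0}, not L_{2,1}. *)
Definition smoothness_const (B : 'Hom(E, 'Hom(E, R^o))) f (q : R) : \bar R :=
  if q < 3 then holder_const B f 2 (q - 2) else holder_const B f 3 (q - 3).

Definition Halpha (B : 'Hom(E, 'Hom(E, R^o))) f (alpha t : R) : \bar R :=
  ereal_inf
    [set (poweR (6%:E * smoothness_const B f q) (q - 1)^-1
           * ((t^-1) `^ (alpha - (q - 2) / (q - 1)))%:E)%E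
    | q in [set q : R | 2 <= q <= 4]].

End Derivatives.

Section ConvexExtended.
Variables (R : realType) (E : normedVectType R).
Implicit Types psi : E -> \bar R.

Definition edom psi : set E := [set x | (psi x < +oo)%E].

Definition epigraph psi : set (E * R^o) :=
  [set z | (psi z.1 <= (z.2 : R)%:E)%E].

Definition proper_closed_convex psi : Prop :=
  [/\ forall x, psi x != -oo%E,
      edom psi !=set0,
      closed (epigraph psi) &
      convex_set (epigraph psi : set (convex_lmodType (E * R^o)%type))].

Definition subgradient psi (x : E) (s : 'Hom(E, R^o)) : Prop :=
  forall y : E, (psi x + (s (y - x))%:E <= psi y)%E.

Definition is_argmin (m : E -> \bar R) (z : E) : Prop :=
  forall y : E, (m z <= m y)%E.

End ConvexExtended.

(* State (x_k, psi'(x_k), H_k) of the method. *)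
Record state (R : realType) (E : normedVectType R) := State {
  st_point : E;
  st_subgrad : 'Hom(E, R^o);
  st_reg : R
}.

Section SuperUniversalNewton.
Variables (R : realType) (E : normedVectType R).
Variables (B : 'Hom(E, 'Hom(E, R^o))) (f : E -> R^o) (psi : E -> \bar R).
Variable alpha : R.
Implicit Types st : state E.

(* F'(x_k) and g_k *)
Definition compgrad st : 'Hom(E, R^o) :=
  gradient f (st_point st) + st_subgrad st.

Definition grad_norm st : R := dnorm B (compgrad st).

Definition reg_coef st (j : nat) : R := 4 ^+ j * st_reg st * grad_norm st `^ alpha.

Definition newton_model (x : E) (lam : R) (y : E) : \bar R :=
  ((gradient f x (y - x) + 2^-1 * hessian f x (y - x) (y - x)
     + lam / 2 * enorm B (y - x) ^+ 2)%:E + psi y)%E.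

(* [trial st j st'] : st' is what the trial with inner index j at st proposes as
   the next state.  The membership of [st_subgrad st'] in the subdifferential of
   psi at [st_point st'] is the optimality condition of the minimization, hence
   not required separately. *)
Definition trial st (j : nat) st' : Prop :=
  let d := st_point st' - st_point st in
  [/\ is_argmin (newton_model (st_point st) (reg_coef st j)) (st_point st'),
      st_subgrad st' = - gradient f (st_point st) - hessian f (st_point st) d
                    - reg_coef st j *: B d &
      st_reg st' = 4 ^+ j * st_reg st / 4].

Definition accepted st (j : nat) st' : Prop :=
  (4 * reg_coef st j)^-1 * dnorm B (compgrad st') ^+ 2
    <= compgrad st' (st_point st - st_point st').

Definition iteration st (j : nat) st' : Prop :=
  [/\ trial st j st', accepted st j st' &
      forall i st'', (i < j)%N -> trial st i st'' -> ~ accepted st i st''].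

(* First k iterations of the method, j i being the accepted inner index of
   iteration i.  Termination of the inner searches is not presupposed: the
   sequences are constrained at iteration i only if its inner search stops. *)
Definition sun_execution (k : nat) (st : nat -> state E) (j : nat -> nat) :
    Prop :=
  forall i, (i < k)%N ->
    (exists j' st', iteration (st i) j' st') ->
    iteration (st i) (j i) (st i.+1).

End SuperUniversalNewton.

Definition oracle_calls (j : nat -> nat) (k : nat) : nat :=
  (\sum_(0 <= i < k) (1 + j i))%N.

Definition log2 (R : realType) (x : R) : R := ln x / ln 2.

(* Main.v *)
Require Import Defs.
From HB Require Import structures.
From mathcomp Require Import all_boot all_order all_algebra.
From mathcomp Require Import all_classical all_reals all_analysis.
From mathcomp Require Import ring lra.

Set Implicit Arguments.
Unset Strict Implicit.
Unset Printing Implicit Defensive.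

Import Order.TTheory GRing.Theory Num.Theory.
Import numFieldNormedType.Exports.
Import VectorInternalTheory.

Local Open Scope classical_set_scope.
Local Open Scope ring_scope.

(* Write d = x_+ - x, r = |d|, g = |F'(x)|_*, tau = g / lambda, and let
   e = grad f(x_+) - grad f(x) - hess f(x) d be the linearization error.  Then
   F'(x_+) = e - lambda B d, and expanding |F'(x_+)|_*^2 shows that a trial is
   accepted as soon as |e|_* <= lambda r.  Monotonicity of the subdifferential
   of psi gives <hess f(x) d, d> + lambda r^2 <= g r, hence r <= tau.  The
   inequality H >= (6 M_q)^(1/(q-1)) g^-(alpha - (q-2)/(q-1)) for
   lambda = H g^alpha amounts to 6 M_q tau^(q-2) <= lambda, and implies
   |e|_* <= lambda r: for q < 3 by the mean value theorem; for q >= 3 because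
   convexity, in the form 0 <= D^2 f(x - tau u)[d,d] for unit u, bounds
   tau D^3 f(x)[u,d,d] by <hess f(x) d, d> + M_q tau^(q-2) r^2, and
   D^3 f(x)[d,d,u] = D^3 f(x)[u,d,d].
     So a rejected trial satisfies 4^j H_k < H_alpha(g_k).  If instead j_k = 0,
   acceptance at the previous iteration gives g_k <= 4 g_{k-1}, whence
   H_k / 4 <= H_alpha(g_{k-1}) / 4 <= H_alpha(g_k), since the exponents of 1/t
   in H_alpha lie in [0,1].  The bound on N_k follows from
   H_k = H_0 4^(j_0 + ... + j_{k-1} - k). *)

(** * The Euclidean norm and its dual *)

Section EuclideanNorm.
Variables (R : realType) (E : normedVectType R) (B : 'Hom(E, 'Hom(E, R^o))).
Hypotheses (B_sa : self_adjoint B) (B_pd : positive_definite B).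
Implicit Types (x y h u v w : E) (s : 'Hom(E, R^o)).

Lemma formDl x y h : B (x + y) h = B x h + B y h.
Proof. by rewrite linearD add_lfunE. Qed.

Lemma formDr x y h : B h (x + y) = B h x + B h y.
Proof. by rewrite linearD. Qed.

Lemma formZl (a : R) x h : B (a *: x) h = a * B x h.
Proof. by rewrite linearZ scale_lfunE. Qed.

Lemma formZr (a : R) x h : B h (a *: x) = a * B h x.
Proof. by rewrite linearZ. Qed.

Lemma formNl x h : B (- x) h = - B x h.
Proof. by rewrite linearN opp_lfunE. Qed.

Lemma formNr x h : B h (- x) = - B h x.
Proof. by rewrite linearN. Qed.

Lemma form_ge0 x : 0 <= B x x.
Proof.
by have [->|/B_pd/ltW//] := eqVneq x 0; rewrite linear0.
Qed.

Lemma enorm_ge0 x : 0 <= enorm B x.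
Proof. exact: sqrtr_ge0. Qed.

Lemma sqr_enorm x : enorm B x ^+ 2 = B x x.
Proof. by rewrite sqr_sqrtr// form_ge0. Qed.

Lemma enorm_gt0 x : (0 < enorm B x) = (x != 0).
Proof.
have [->|xn0] := eqVneq x 0; last by rewrite sqrtr_gt0 B_pd.
by rewrite /enorm linear0 sqrtr0 ltxx.
Qed.

Lemma enorm0 : enorm B 0 = 0.
Proof. by rewrite /enorm linear0 sqrtr0. Qed.

Lemma enormZ (a : R) x : enorm B (a *: x) = `|a| * enorm B x.
Proof.
rewrite /enorm formZl formZr mulrA -expr2 sqrtrM ?sqr_ge0//.
by rewrite sqrtr_sqr.
Qed.

Lemma enormN x : enorm B (- x) = enorm B x.
Proof. by rewrite /enorm formNl formNr opprK. Qed.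

(** Positivity of the form at |y| x - |x| y reads 2 |x| |y| (|x| |y| - B x y) >= 0. *)
Lemma form_CauchySchwarz x y : B x y <= enorm B x * enorm B y.
Proof.
have [->|xn0] := eqVneq x 0; first by rewrite linear0 lfunE/= enorm0 mul0r.
have [->|yn0] := eqVneq y 0; first by rewrite linear0 enorm0 mulr0.
have nx : 0 < enorm B x by rewrite enorm_gt0.
have ny : 0 < enorm B y by rewrite enorm_gt0.
have := form_ge0 (enorm B y *: x - enorm B x *: y).
rewrite !(formDl, formDr, formNl, formNr, formZl, formZr) (B_sa y x).
rewrite -!sqr_enorm; set a := enorm B x; set b := enorm B y => H.
have ab : 0 < a * b by apply: mulr_gt0.
rewrite -(ler_pM2l ab); nra.
Qed.

Lemma lker_form : (lker B == 0)%VS.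
Proof.
apply/lker0P => x y Bxy; apply/eqP; rewrite -subr_eq0; apply/negP => /negP.
by move/B_pd; rewrite formDl formNl Bxy subrr ltxx.
Qed.

(** B is injective and the dual of E has the same dimension as E, so B is onto. *)
Lemma form_invK s : B ((B^-1)%VF s) = s.
Proof.
apply: (limg_lfunVK (f := B)).
suff -> : limg B = fullv by rewrite memvf.
apply/eqP; rewrite eqEdim subvf/= limg_dim_eq ?(eqP lker_form) ?capv0//.
by rewrite !dimvf /dim/= muln1.
Qed.

Lemma dnormE s : dnorm B s = enorm B ((B^-1)%VF s).
Proof. by rewrite /dnorm /enorm form_invK. Qed.

Lemma dnorm_ge0 s : 0 <= dnorm B s.
Proof. exact: sqrtr_ge0. Qed.

Lemma dnorm_le s x : s x <= dnorm B s * enorm B x.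
Proof. by rewrite -{1}(form_invK s) dnormE form_CauchySchwarz. Qed.

(** At the Riesz representative u = B^-1 s one has s u = |u|^2, so the hypothesis becomes |u|^2 <= c
    |u|. *)
Lemma dnorm_bound s (c : R) :
  0 <= c -> (forall u, s u <= c * enorm B u) -> dnorm B s <= c.
Proof.
move=> c0 sc; rewrite dnormE; set u := (B^-1)%VF s.
have := sc u; rewrite -{1}(form_invK s) -/u -sqr_enorm expr2.
have [->|un0] := eqVneq u 0; first by rewrite enorm0.
by rewrite ler_pM2r // enorm_gt0.
Qed.

End EuclideanNorm.

(** * Topology of finite-dimensional spaces *)

(** The constant is the minimum of N on the compact unit sphere, extended by homogeneity. Applied to
    the norm of E and to the Euclidean norm, both read in coordinates, it gives one half of the
    equivalence of norms. *)
Lemma homogeneous_lower_bound (R : realType) n (N : 'rV[R]_n -> R) :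
  continuous N -> (forall a v, N (a *: v) = `|a| * N v) ->
  (forall v, v != 0 -> 0 < N v) ->
  exists2 c, 0 < c & forall v, c * `|v| <= N v.
Proof.
move=> Nc Nh Npos.
have [[v0 v0n0]|all0] := pselect (exists v : 'rV[R]_n, v != 0); last first.
  exists 1 => // v; have [->|vn0] := eqVneq v 0; last by case: all0; exists v.
  by rewrite normr0 mulr0 -(scale0r (0 : 'rV_n)) Nh normr0 mul0r.
have unit_normalize (v : 'rV[R]_n) : v != 0 -> `| `|v|^-1 *: v| = 1.
  by move=> vn0; rewrite normrZV// unitfE normr_eq0.
pose S := [set v : 'rV[R]_n | `|v| = 1].
have Sc : compact S.
  apply: bounded_closed_compact.
    by exists 1; split=> // r r1 v /= ->; exact: ltW.
  have /continuous_closedP := @norm_continuous R 'rV[R]_n.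
  move=> norm_closed; apply: (norm_closed [set 1]); exact: closed_eq.
have [|c /set_mem Sc1 cmin] :=
    compact_EVT_min (A := S) _ Sc (continuous_subspaceT Nc).
  by exists (`|v0|^-1 *: v0); exact: unit_normalize.
have cn0 : c != 0 by rewrite -normr_eq0 Sc1 oner_neq0.
exists (N c); first exact: Npos.
move=> v; have [->|vn0] := eqVneq v 0.
  by rewrite normr0 mulr0 -(scale0r (0 : 'rV_n)) Nh normr0 mul0r.
have := cmin (`|v|^-1 *: v) (mem_set (unit_normalize v vn0)).
rewrite Nh ger0_norm ?invr_ge0// mulrC ler_pdivlMr ?normr_gt0//.
Qed.

Section FiniteDimensionalTopology.
Variables (R : realType) (E : normedVectType R).
Implicit Types (A : 'Hom(E, 'Hom(E, R^o))) (s : 'Hom(E, R^o)).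

Lemma r2v_sum (v : 'rV[R]_(dim E)) :
  r2v v = \sum_i v 0 i *: (r2v (delta_mx 0 i) : E).
Proof.
by rewrite {1}[v]row_sum_delta linear_sum; apply: eq_bigr => i _; rewrite linearZ.
Qed.

Lemma r2v_continuous : continuous (r2v : 'rV[R]_(dim E) -> E).
Proof.
rewrite (_ : r2v = fun v => \sum_i v 0 i *: (r2v (delta_mx 0 i) : E)); last first.
  by apply/funext => v; exact: r2v_sum.
apply: (continuous_big (@add_continuous E)) => i _ v; apply: (@cvgZr_tmp _ _ _ (nbhs v)).
exact: (@coord_continuous R 1 (dim E) 0 i v).
Qed.

Lemma norm_r2v_lower_bound :
  exists2 c : R, 0 < c & forall v : 'rV[R]_(dim E), c * `|v| <= `|r2v v : E|.
Proof.
apply: homogeneous_lower_bound.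
- move=> v; apply: continuous_comp; first exact: r2v_continuous.
  exact: norm_continuous.
- by move=> a v; rewrite linearZ normrZ.
- by move=> v vn0; rewrite normr_gt0 raddf_eq0//; exact: r2v_inj.
Qed.

(** The lower bound on |r2v v| is exactly boundedness of the inverse linear map. *)
Lemma v2r_continuous : continuous (v2r : E -> 'rV[R]_(dim E)).
Proof.
have [c c0 cv] := norm_r2v_lower_bound.
apply: (@bounded_linear_continuous R E 'rV[R]_(dim E) v2r).
apply/linear_boundedP; exists c^-1; split; first exact: num_real.
move=> r cr x; rewrite (@le_trans _ _ (c^-1 * `|x|))//.
  by rewrite ler_pdivlMl// -{2}(v2rK x); exact: cv.
by rewrite ler_wpM2r// ltW.
Qed.

Lemma v2r_coord_continuous i : continuous (fun x : E => (v2r x) 0 i : R).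
Proof.
move=> x; have := continuous_comp (g := fun v : 'rV[R]_(dim E) => v 0 i)
  (@v2r_continuous x); apply.
exact: (@coord_continuous R 1 (dim E) 0 i).
Qed.

Lemma lfun_continuous s : continuous s.
Proof.
rewrite (_ : (s : E -> R^o) =
    fun x => \sum_i (v2r x) 0 i * s (r2v (delta_mx 0 i))); last first.
  apply/funext => x; rewrite -{1}(v2rK x) r2v_sum linear_sum.
  by apply: eq_bigr => i _; rewrite linearZ.
apply: (continuous_big (@add_continuous R^o)) => i _ x; apply: (@cvgMr_tmp _ _ (nbhs x)).
exact: v2r_coord_continuous.
Qed.

Lemma quadratic_continuous A : continuous (fun x => A x x : R).
Proof.
rewrite (_ : (fun x => A x x) =
    fun x => \sum_i (v2r x) 0 i * A (r2v (delta_mx 0 i)) x); last first.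
  apply/funext => x; rewrite -{1}(v2rK x) r2v_sum linear_sum sum_lfunE.
  by apply: eq_bigr => i _; rewrite linearZ scale_lfunE.
apply: (continuous_big (@add_continuous R^o)) => i _ x.
by apply: (@cvgM _ _ (nbhs x)); [exact: v2r_coord_continuous|exact: lfun_continuous].
Qed.

(** Heine-Borel transported from row vectors: the coordinate set of K is bounded by the lower bound
    on |r2v v|, and K is its continuous image. *)
Lemma bounded_closed_compact_vect (K : set E) :
  bounded_set K -> closed K -> compact K.
Proof.
move=> Kb Kcl.
have [c c0 cv] := norm_r2v_lower_bound.
pose P : set 'rV[R]_(dim E) := r2v @^-1` K.
have -> : K = r2v @` P.
  apply/seteqP; split => [x Kx|_ [v Pv <-]//].
  by exists (v2r x); rewrite /P/= v2rK.
apply: continuous_compact.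
  exact/continuous_subspaceT/r2v_continuous.
apply: bounded_closed_compact; last first.
  by have /continuous_closedP rcl := r2v_continuous; exact: rcl.
case: Kb => M [_ KM]; exists (c^-1 * (M + 1)); split; first exact: num_real.
move=> r cr v Pv /=; apply: le_trans (ltW cr).
by rewrite ler_pdivlMl// (le_trans (cv v))//; apply: KM; rewrite ?ltrDl.
Qed.

Lemma enorm_lower_bound (B : 'Hom(E, 'Hom(E, R^o))) : positive_definite B ->
  exists2 c : R, 0 < c & forall x : E, c * `|x| <= enorm B x.
Proof.
move=> B_pd.
have [|a v|v vn0|c c0 cv] :=
    @homogeneous_lower_bound R (dim E) (fun v => enorm B (r2v v)).
- move=> v; apply: (continuous_comp (@r2v_continuous v)).
  apply: (continuous_comp (@quadratic_continuous B (r2v v))).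
  exact: sqrt_continuous.
- by rewrite linearZ enormZ.
- by rewrite enorm_gt0// raddf_eq0//; exact: r2v_inj.
have /linear_boundedP [M [_ rM]] :=
  (@linear_bounded_continuous R 'rV[R]_(dim E) E r2v).2 r2v_continuous.
(* [M + 1] because the operator bound is only known strictly above [M]; the maximum with 1 ensures
   positivity. *)
pose m := Num.max 1 (M + 1).
have m0 : 0 < m by rewrite lt_max ltr01.
exists (c / m); first exact: divr_gt0.
move=> x; rewrite mulrAC ler_pdivrMr//.
have xm : `|x| <= m * `|v2r x|.
  by rewrite -{1}(v2rK x); apply: rM; rewrite lt_max ltrDl ltr01 orbT.
have cx : c * `|v2r x| <= enorm B x by rewrite -{2}(v2rK x); exact: cv.
rewrite (@le_trans _ _ (c * (m * `|v2r x|)))// ?ler_pM2l//.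
by rewrite mulrCA mulrC ler_pM2r.
Qed.

End FiniteDimensionalTopology.

(** * Second and third differentials *)

Lemma convex_function_le (R : realType) (V : lmodType R) (f : V -> R^o) :
  convex_function [set: convex_lmodType V] f ->
  forall (p : R) (a b : V), 0 <= p <= 1 ->
    f (p *: a + (1 - p) *: b) <= p * f a + (1 - p) * f b.
Proof.
move=> cf p a b /andP[p0 p1].
exact: cf (Itv01 p0 p1) a b (in_setT _) (in_setT _).
Qed.

Section SecondDifference.
Variables (R : realType) (V : normedModType R).
Implicit Types (g f : V -> R^o) (x h k : V).

Lemma is_derive_line g x h (t : R) : differentiable g (x + t *: h) ->
  is_derive t 1 (fun s => g (x + s *: h) : R) ('d g (x + t *: h) h).
Proof.
move=> dg; have dv := diff_derivable (v := h) dg.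
have E : (fun s : R => s^-1 *: (((fun s => g (x + s *: h) : R) \o shift t) (s *: 1) -
            g (x + t *: h))) =
       (fun s => s^-1 *: ((g \o shift (x + t *: h)) (s *: h) - g (x + t *: h))).
  apply/funext => s /=; congr (_ *: (g _ - _)).
  by rewrite scalerDl addrCA /GRing.scale/= mulr1.
split; first by rewrite /derivable E.
by rewrite -deriveE// /derive E.
Qed.

Lemma line_MVT g x h : (forall y, differentiable g y) ->
  exists2 th : R, 0 < th < 1 & g (x + h) - g x = 'd g (x + th *: h) h.
Proof.
move=> dg.
have [|s _||th] := @MVT R (fun s => g (x + s *: h)) (fun s => 'd g (x + s *: h) h) 0 1.
- exact: ltr01.
- exact: is_derive_line.
- apply: continuous_subspaceT => s; apply: differentiable_continuous.
  by apply/derivable1_diffP; have [] := is_derive_line (dg (x + s *: h)).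
by rewrite in_itv/= scale1r scale0r addr0 subr0 mulr1 => ?; exists th.
Qed.

(** One theta serves both increments because the mean value theorem is applied to s -> g (x + s h) -
    g (y + s h). *)
Lemma line_MVT_diff g x y h : (forall z, differentiable g z) ->
  exists2 th : R, 0 < th < 1 &
    g (x + h) - g x - (g (y + h) - g y) =
    'd g (x + th *: h) h - 'd g (y + th *: h) h.
Proof.
move=> dg.
pose p s : R := g (x + s *: h) - g (y + s *: h).
pose dp s : R := 'd g (x + s *: h) h - 'd g (y + s *: h) h.
have pP (s : R) : is_derive s (1 : R) p (dp s).
  by apply: is_deriveB; exact: is_derive_line.
have [//||th] := @MVT R p dp 0 1.
- apply: continuous_subspaceT => s; apply: differentiable_continuous.
  by apply/derivable1_diffP; have [] := pP s.
rewrite in_itv/= subr0 mulr1 /p scale1r scale0r !addr0 => ? E.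
by exists th => //; rewrite -[RHS]E; ring.
Qed.

Lemma differentiable_remainder g x (e : R) : differentiable g x -> 0 < e ->
  exists2 d : R, 0 < d &
    forall v, `|v| < d -> `|g (x + v) - g x - 'd g x v| <= e * `|v|.
Proof.
move=> /diff_locally /eqaddoP dg e0.
have /nbhs_norm0P[d d0 H] := dg _ e0.
exists d => // v /H /=.
suff -> : (g \o shift x - (cst (g x) + 'd g x)) v = g (x + v) - g x - 'd g x v by [].
by rewrite -addrA -opprD [x + v]addrC.
Qed.

(* The remainder is o(t^2) although the differential is not assumed continuous:
   the mean value theorem is applied to a difference of two values of f, so that
   only differentiability of ['d f _ h] at x is needed. *)
Lemma second_difference f x h k (e : R) :
  (forall y, differentiable f y) -> differentiable (fun y => 'd f y h : R^o) x ->
  0 < e ->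
  exists2 d : R, 0 < d & forall t : R, 0 < t < d ->
    `|f (x + t *: h + t *: k) - f (x + t *: h) - f (x + t *: k) + f x
      - t ^+ 2 * 'd (fun y => 'd f y h : R^o) x k| <= e * t ^+ 2.
Proof.
move=> df dg e0; set g := fun y => 'd f y h : R^o.
pose C : R := `|k| + `|h| + 1.
have C0 : 0 < C by rewrite ltr_wpDl// addr_ge0.
have [|d d0 rem] := differentiable_remainder (e := e / (2 * C)) dg.
  by rewrite divr_gt0// mulr_gt0.
exists (d / C); first exact: divr_gt0.
move=> t /andP[t0]; rewrite ltr_pdivlMr// => tC.
have [th /andP[th0 th1] E] := line_MVT_diff (x + t *: k) x (t *: h) df.
(* [x + u] and [x + v] are the intermediate points; u - v = t k, and both displacements have norm at
   most t C. *)
set u := t *: k + th *: (t *: h); set v := th *: (t *: h).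
have thh : th * `|h| <= `|h| by rewrite ler_piMl// ltW.
have vE : `|v| = t * (th * `|h|) by rewrite !normrZ !gtr0_norm// mulrCA.
have k_ge0 := normr_ge0 k.
have vC : `|v| <= t * C by rewrite vE ler_pM2l// /C; lra.
have uC : `|u| <= t * C.
  rewrite (le_trans (ler_normD _ _))// vE normrZ gtr0_norm// -mulrDr.
  by rewrite ler_pM2l// /C; lra.
have := rem u (le_lt_trans uC tC); have := rem v (le_lt_trans vC tC).
rewrite -!/(g _).
have -> : f (x + t *: h + t *: k) - f (x + t *: h) - f (x + t *: k) + f x =
    t * (g (x + u) - g (x + v)).
  rewrite mulrBr /u addrA [x + t *: h + _]addrAC.
  transitivity (f (x + t *: k + t *: h) - f (x + t *: k) - (f (x + t *: h) - f x)).
    by ring.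
  have gZ y : 'd f y (t *: h) = t * g y by rewrite linearZ.
  by rewrite E !gZ.
have -> : 'd g x k = t^-1 * ('d g x u - 'd g x v).
  rewrite /u linearD addrK.
  have -> : 'd g x (t *: k) = t * 'd g x k by rewrite linearZ.
  by rewrite mulKf// gt_eqF.
set a := 'd g x u; set b := 'd g x v; rewrite -/g -/a -/b => Hv Hu.
have -> : t * (g (x + u) - g (x + v)) - t ^+ 2 * (t^-1 * (a - b)) =
    t * ((g (x + u) - g x - a) - (g (x + v) - g x - b)).
  by field; rewrite gt_eqF.
rewrite normrM gtr0_norm// expr2 mulrCA ler_pM2l//.
rewrite (le_trans (ler_normB _ _))//.
have -> : e * t = e / (2 * C) * (t * C) + e / (2 * C) * (t * C).
  by field; rewrite gt_eqF.
have eC : 0 <= e / (2 * C) by rewrite divr_ge0 ?ltW// mulr_gt0.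
by apply: lerD; [apply: (le_trans Hu)|apply: (le_trans Hv)]; exact: ler_wpM2l.
Qed.

(** The second difference is symmetric in h and k, so for small t both mixed derivatives lie within
    e/2 of the same quotient. *)
Lemma second_diff_sym f x h k :
  (forall y, differentiable f y) ->
  differentiable (fun y => 'd f y h : R^o) x ->
  differentiable (fun y => 'd f y k : R^o) x ->
  'd (fun y => 'd f y h : R^o) x k = 'd (fun y => 'd f y k : R^o) x h.
Proof.
move=> df dh dk.
set a : R := LHS; set b : R := RHS; suff : `|a - b| <= 0.
  by rewrite normr_le0 subr_eq0 => /eqP.
apply/ler_addgt0Pr => e e0; rewrite add0r.
have [|d1 d10] := @second_difference f x h k (e / 2) df dh; first by lra.
rewrite -/a => H1.
have [|d2 d20] := @second_difference f x k h (e / 2) df dk; first by lra.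
rewrite -/b => H2.
pose t := Num.min d1 d2 / 2.
have m0 : 0 < Num.min d1 d2 by rewrite lt_min d10.
have t0 : 0 < t by rewrite /t; lra.
have /andP[t1 t2] : (t < d1) && (t < d2) by rewrite -lt_min /t; lra.
have /H1 := introT andP (conj t0 t1); have /H2 := introT andP (conj t0 t2).
rewrite [x + t *: k + _]addrAC !ler_norml.
move=> /andP[A1 A2] /andP[A3 A4].
have tt : 0 < t ^+ 2 by rewrite exprn_gt0.
by apply/andP; split; rewrite -(ler_pM2l tt); lra.
Qed.

(** For k = -h the second difference is 2 f(x) - f(x + t h) - f(x - t h), nonpositive by midpoint
    convexity, and it approximates -t^2 D^2 f(x)[h,h]. *)
Lemma convex_second_diff_ge0 f x h :
  convex_function [set: convex_lmodType V] f ->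
  (forall y, differentiable f y) ->
  differentiable (fun y => 'd f y h : R^o) x ->
  0 <= 'd (fun y => 'd f y h : R^o) x h.
Proof.
move=> cf df dh; apply/ler_addgt0Pr => e e0.
have [d d0 H] := @second_difference f x h (- h) e df dh e0.
have t0 : 0 < d / 2 by lra.
have /H : 0 < d / 2 < d by apply/andP; split; lra.
set t := d / 2 in t0 *.
rewrite scalerN addrK linearN /= => /ler_normlP[+ _].
have half01 : (0 <= 2^-1 :> R) && (2^-1 <= 1 :> R) by apply/andP; split; lra.
have := convex_function_le cf (x + t *: h) (x - t *: h) half01.
have -> : 1 - 2^-1 = 2^-1 :> R by field.
have -> : 2^-1 *: (x + t *: h) + 2^-1 *: (x - t *: h) = x.
  rewrite -scalerDr addrACA subrr addr0 -mulr2n -[x *+ 2]scaler_nat scalerA.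
  by rewrite mulVf ?pnatr_eq0// scale1r.
move=> Hc Hd.
have tt : 0 < t ^+ 2 by rewrite exprn_gt0.
by rewrite -(ler_pM2l tt) mulr0 mulrDr; lra.
Qed.

End SecondDifference.

(** * Iterated derivatives as symmetric multilinear forms *)

Section Nabla.
Variables (R : realType) (E : normedVectType R).
Implicit Types (f : E -> R^o) (x y h u v : E).

Lemma ntimes_differentiable_le m n f : (m <= n)%N ->
  ntimes_differentiable n f -> ntimes_differentiable m f.
Proof. by move=> mn fn hs hsm; apply: fn; exact: leq_trans hsm mn. Qed.

Lemma nabla_differentiable_dir f p h :
  ntimes_differentiable p.+1 f -> ntimes_differentiable p (nabla f [:: h]).
Proof.
move=> fp hs hsp x.
have -> : nabla (nabla f [:: h]) hs = nabla f (rcons hs h).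
  by elim: hs {hsp} => //= v hs ->.
by apply: fp; rewrite size_rcons ltnS.
Qed.

Lemma nabla_scale f (ps : seq (R * E)) x : ntimes_differentiable (size ps) f ->
  nabla f [seq p.1 *: p.2 | p <- ps] x =
  \prod_(p <- ps) p.1 * nabla f [seq p.2 | p <- ps] x.
Proof.
elim: ps x => [|[a h] ps IH] x fd /=; first by rewrite big_nil mul1r.
have fd' := ntimes_differentiable_le (leqnSn _) fd.
have -> : nabla f [seq p.1 *: p.2 | p <- ps] =
    (\prod_(p <- ps) p.1) *: nabla f [seq p.2 | p <- ps].
  by apply/funext => y; rewrite IH.
rewrite diffZ ?big_cons/=; last by apply: fd; rewrite size_map.
rewrite linearZ /= /GRing.scale/=; ring.
Qed.

Lemma gradientE f x v : gradient f x v = nabla f [:: v] x.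
Proof. by rewrite lfunE. Qed.

Section SecondOrder.
Variable f : E -> R^o.
Hypothesis f2 : ntimes_differentiable 2 f.

Let f1 : forall y, differentiable f y.
Proof. by move=> y; exact: (f2 (hs := [::])). Qed.

Let df1 h : forall y, differentiable (nabla f [:: h]) y.
Proof. by move=> y; exact: (f2 (hs := [:: h])). Qed.

(** The inner direction is linear only once the combination has passed through the outer
    differential. This is what makes [linfun] in [hessian] return the intended form. *)
Lemma nabla2_linear x h : linear (fun v => nabla f [:: h; v] x : R^o).
Proof.
move=> a u v /=.
have -> : (fun y => 'd f y (a *: u + v) : R^o) =
    a *: (nabla f [:: u]) + nabla f [:: v].
  by apply/funext => y /=; rewrite linearP.
have du := @df1 u x; have dv := @df1 v x.
by rewrite diffD ?diffZ//; exact: differentiableZ.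
Qed.

Lemma hessianE x h v : hessian f x h v = nabla f [:: h; v] x.
Proof.
pose g : {linear E -> R^o} := HB.pack (fun v => nabla f [:: h; v] x : R^o)
  (GRing.isLinear.Build _ _ _ _ _ (nabla2_linear x h)).
exact: (lfunE g v).
Qed.

Lemma nabla2_sym x h v : nabla f [:: h; v] x = nabla f [:: v; h] x.
Proof. by apply: second_diff_sym => //; exact: df1. Qed.

Lemma nabla2_ge0 x h : convex_function [set: convex_lmodType E] f ->
  0 <= nabla f [:: h; h] x.
Proof. by move=> cf; apply: convex_second_diff_ge0 => //; exact: df1. Qed.

End SecondOrder.

(** Two transpositions: the inner pair at every point, then the outer pair for the function [nabla f
    [:: h]]. *)
Lemma nabla3_swap f x h v : ntimes_differentiable 3 f ->
  nabla f [:: h; h; v] x = nabla f [:: v; h; h] x.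
Proof.
move=> f3.
have f2 := ntimes_differentiable_le (leqnSn 2) f3.
transitivity (nabla f [:: h; v; h] x).
  rewrite /= (_ : (fun y => 'd (fun z => 'd f z v : R^o) y h : R^o) =
     (fun y => 'd (fun z => 'd f z h : R^o) y v : R^o))//.
  by apply/funext => y; exact: (nabla2_sym f2 y h v).
exact: (nabla2_sym (nabla_differentiable_dir h f3) x h v).
Qed.

End Nabla.

(** * Pointwise bounds from the Hölder constants *)

Section HoelderBound.
Variables (R : realType) (E : normedVectType R) (B : 'Hom(E, 'Hom(E, R^o))).
Hypothesis B_pd : positive_definite B.
Variables (f : E -> R^o) (p : nat) (nu : R).

Lemma enorm_normalize (h : E) : enorm B h *: ((enorm B h)^-1 *: h) = h.
Proof.
have [->|hn0] := eqVneq h 0; first by rewrite !scaler0.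
by rewrite scalerA mulfV ?scale1r// gt_eqF// enorm_gt0.
Qed.

Lemma enorm_unit_le1 (h : E) : enorm B ((enorm B h)^-1 *: h) <= 1.
Proof.
rewrite enormZ ger0_norm ?invr_ge0 ?enorm_ge0//.
have [->|hn0] := eqVneq h 0; first by rewrite enorm0 mulr0.
by rewrite mulVf// gt_eqF// enorm_gt0.
Qed.

Lemma holder_const_differentiable :
  (holder_const B f p nu < +oo)%E -> ntimes_differentiable p f.
Proof. by rewrite /holder_const; case: asboolP. Qed.

Lemma holder_const_unit_bound (h : p.-tuple E) x y :
  (holder_const B f p nu < +oo)%E -> x != y ->
  (forall i, enorm B (tnth h i) <= 1) ->
  (((nabla f h x - nabla f h y) / enorm B (x - y) `^ nu)%:E
    <= holder_const B f p nu)%E.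
Proof.
move=> fin xy h1; have fd := holder_const_differentiable fin.
rewrite /holder_const asboolT//.
have r0 : 0 < enorm B (x - y) `^ nu.
  by rewrite powR_gt0// enorm_gt0// subr_eq0.
apply: le_trans (ereal_sup_ubound _); last by exists (x, y).
rewrite EFinM; apply: lee_wpmul2r; first by rewrite lee_fin invr_ge0 ltW.
by apply: ereal_sup_ubound; exists h.
Qed.

(** At the pair (v, 0) with all arguments zero the quotient is 0. In a trivial space the supremum
    would be over the empty set, hence -oo. *)
Lemma holder_const_ge0 (v : E) : (0 < p)%N -> v != 0 ->
  (holder_const B f p nu < +oo)%E -> (0 <= holder_const B f p nu)%E.
Proof.
move=> p0 v0 fin.
have z0 : size (nseq p (0 : E)) == p by rewrite size_nseq.
apply: le_trans (holder_const_unit_bound (h := Tuple z0) fin v0 _); last first.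
  by move=> i; rewrite (tnth_nth 0)/= nth_nseq if_same enorm0.
have n0 z : nabla f (nseq p 0) z = 0 by case: p p0 => // n _; rewrite /= linear0.
by rewrite /= !n0 subrr mul0r.
Qed.

(** Multilinearity pulls the norms of the arguments out and leaves arguments of norm at most 1, to
    which the supremum applies. *)
Lemma holder_const_bound hs x y :
  (holder_const B f p nu < +oo)%E -> (0 <= holder_const B f p nu)%E ->
  size hs = p ->
  nabla f hs x - nabla f hs y <=
    fine (holder_const B f p nu) * enorm B (x - y) `^ nu
    * \prod_(h <- hs) enorm B h.
Proof.
move=> fin pos sz.
have L0 : 0 <= fine (holder_const B f p nu) by exact: fine_ge0.
have P0 : 0 <= \prod_(h <- hs) enorm B h.
  by apply: prodr_ge0 => h _; exact: enorm_ge0.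
have [->|xy] := eqVneq x y.
  by rewrite subrr !mulr_ge0// powR_ge0.
have fd := holder_const_differentiable fin.
pose ps := [seq (enorm B h, (enorm B h)^-1 *: h) | h <- hs].
have hsE : hs = [seq q.1 *: q.2 | q <- ps].
  by rewrite -map_comp map_id_in// => h _ /=; exact: enorm_normalize.
have psz : size ps = p by rewrite size_map.
have dps : ntimes_differentiable (size ps) f by rewrite psz.
rewrite {1 2}hsE !nabla_scale// -mulrBr big_map/= mulrC ler_wpM2r//.
have us : size [seq q.2 | q <- ps] == p by rewrite size_map psz.
have := @holder_const_unit_bound (Tuple us) x y fin xy.
rewrite -{1}(fineK (x := holder_const B f p nu)) ?ge0_fin_numE// => H.
have r0 : 0 < enorm B (x - y) `^ nu.
  by rewrite powR_gt0// enorm_gt0// subr_eq0.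
rewrite -ler_pdivrMr// -lee_fin; apply: H => i.
rewrite (tnth_nth 0)/= -map_comp (nth_map 0) ?enorm_unit_le1//.
by rewrite sz ltn_ord.
Qed.

End HoelderBound.

(** * The linearization error of a regularized Newton step *)

Section RegularizedStep.
Variables (R : realType) (E : normedVectType R) (B : 'Hom(E, 'Hom(E, R^o))).
Hypotheses (B_sa : self_adjoint B) (B_pd : positive_definite B).
Implicit Types (x d u v : E).

(** After clearing 4 lambda and expanding, the claim is |e|_*^2 + 2 lambda <e, d> <= 3 lambda^2 r^2;
    the hypothesis bounds the two terms by lambda^2 r^2 and 2 lambda^2 r^2. *)
Lemma step_progress (e : 'Hom(E, R^o)) d (lam : R) : 0 < lam ->
  dnorm B e <= lam * enorm B d ->
  (4 * lam)^-1 * dnorm B (e - lam *: B d) ^+ 2 <= (e - lam *: B d) (- d).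
Proof.
move=> lam0 he; set v := (B^-1)%VF e.
have Bv : B v = e by rewrite form_invK.
have Bw : e - lam *: B d = B (v - lam *: d).
  apply/lfunP => u; rewrite formDl formNl formZl Bv.
  by rewrite add_lfunE opp_lfunE scale_lfunE.
rewrite Bw dnormE// lker0_lfunK ?lker_form// sqr_enorm//.
rewrite !(formDl, formDr, formNl, formNr, formZl, formZr) (B_sa d v) -!sqr_enorm//.
have nv : enorm B v <= lam * enorm B d by rewrite -dnormE.
have cs := form_CauchySchwarz B_sa B_pd v d.
have r0 := enorm_ge0 B d; have v0 := enorm_ge0 B v.
have P : B v d <= lam * enorm B d ^+ 2.
  by rewrite (le_trans cs)// expr2 mulrA ler_wpM2r.
have V : enorm B v ^+ 2 <= lam ^+ 2 * enorm B d ^+ 2.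
  by rewrite -exprMn !expr2; apply: ler_pM.
rewrite mulrC ler_pdivrMr ?mulr_gt0//.
move: P V; set r := enorm B d; set a := enorm B v ^+ 2; set b := B v d.
move=> P V; nra.
Qed.

Variables (f : E -> R^o).
Hypothesis f_convex : convex_function [set: convex_lmodType E] f.
Hypothesis f2 : ntimes_differentiable 2 f.

Lemma nabla_MVT p hs x h : ntimes_differentiable p f -> (size hs < p)%N ->
  exists2 th : R, 0 < th < 1 &
    nabla f hs (x + h) - nabla f hs x = nabla f (h :: hs) (x + th *: h).
Proof.
move=> fp hsp; exact: (line_MVT x h (g := nabla f hs) (fun y => fp hs hsp y)).
Qed.

Lemma powR_scaled_le (th r tau nu : R) : 0 < th < 1 -> 0 <= r -> r <= tau ->
  0 <= nu -> (th * r) `^ nu <= tau `^ nu.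
Proof.
move=> /andP[th0 th1] r0 rt nu0; apply: ge0_ler_powR => //.
- by rewrite nnegrE mulr_ge0// ltW.
- by rewrite nnegrE (le_trans r0).
- by rewrite (le_trans _ rt)// ler_piMl// ltW.
Qed.

(* [dg] is what monotonicity of the subdifferential of psi says about a step d
   taken at a point where the composite gradient has dual norm g. *)
Variables (x d : E) (lam g : R).
Hypotheses (lam0 : 0 < lam) (g0 : 0 < g).
Hypothesis dg : nabla f [:: d; d] x + lam * enorm B d ^+ 2 <= g * enorm B d.

Lemma step_length : enorm B d <= g / lam.
Proof.
have r0 := enorm_ge0 B d; have h0 := nabla2_ge0 f2 x d f_convex.
rewrite ler_pdivlMr//; have [->|] := eqVneq (enorm B d) 0; first by rewrite mul0r ltW.
move=> rn0; have r1 : 0 < enorm B d by rewrite lt_neqAle eq_sym rn0.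
rewrite -(ler_pM2r r1) mulrAC -expr2 mulrC (le_trans _ dg)// lerDr.
exact: h0.
Qed.

(** The mean value theorem turns the error into a difference of Hessians, evaluated at [d,u], at two
    points within r <= tau of each other. *)
Lemma taylor_remainder_bound2 (L nu : R) u : 0 <= nu -> 0 <= L ->
  (forall hs y z, size hs = 2%N -> nabla f hs y - nabla f hs z <=
     L * enorm B (y - z) `^ nu * \prod_(h <- hs) enorm B h) ->
  L * (g / lam) `^ nu <= lam ->
  nabla f [:: u] (x + d) - nabla f [:: u] x - nabla f [:: d; u] x
    <= lam * enorm B d * enorm B u.
Proof.
move=> nu0 L0 hL hlam.
have [th th01 ->] := nabla_MVT x d f2 (hs := [:: u]) erefl.
apply: (le_trans (hL [:: d; u] _ _ erefl)); rewrite !big_cons big_nil mulr1 mulrA.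
rewrite ler_wpM2r ?enorm_ge0// ler_wpM2r ?enorm_ge0//.
rewrite (le_trans _ hlam)// ler_wpM2l// addrC addKr enormZ.
rewrite gtr0_norm; last by case/andP: th01.
by apply: powR_scaled_le => //; [exact: enorm_ge0|exact: step_length].
Qed.

Lemma taylor_remainder_bound3 (L nu : R) u : 0 <= nu -> 0 <= L ->
  ntimes_differentiable 3 f ->
  (forall hs y z, size hs = 3%N -> nabla f hs y - nabla f hs z <=
     L * enorm B (y - z) `^ nu * \prod_(h <- hs) enorm B h) ->
  6 * (L * (g / lam) `^ (1 + nu)) <= lam ->
  nabla f [:: u] (x + d) - nabla f [:: u] x - nabla f [:: d; u] x
    <= lam * enorm B d * enorm B u.
Proof.
move=> nu0 L0 f3 hL hlam.
set tau := g / lam in hlam *.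
have tau0 : 0 < tau by rewrite divr_gt0.
have tauE : tau `^ (1 + nu) = tau * tau `^ nu.
  by rewrite powRD ?powRr1 ?ltW// (gt_eqF tau0) implybT.
have r0 := enorm_ge0 B d; have u0 := enorm_ge0 B u.
have a0 := nabla2_ge0 f2 x d f_convex.
have rtau : enorm B d <= tau := step_length.
(* Two uses of the mean value theorem turn the error into th D^3 f(z)[d,d,u] with z within r <= tau
   of x. *)
have [th th01 ->] := nabla_MVT x d f2 (hs := [:: u]) erefl.
have [th' th01' ->] := nabla_MVT x (th *: d) f3 (hs := [:: d; u]) erefl.
have [z zd ->] : exists2 z, enorm B (z - x) `^ nu <= tau `^ nu &
    nabla f [:: th *: d; d; u] (x + th' *: (th *: d)) = th * nabla f [:: d; d; u] z.
  exists (x + th' *: (th *: d)); last by rewrite /= linearZ.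
  rewrite addrC addKr scalerA enormZ gtr0_norm.
    apply: powR_scaled_le => //; case/andP: th01 => ? ?; case/andP: th01' => ? ?.
    by apply/andP; split; nra.
  by case/andP: th01 => ? _; case/andP: th01' => ? _; exact: mulr_gt0.
have zx : nabla f [:: d; d; u] z <=
    nabla f [:: u; d; d] x + L * tau `^ nu * (enorm B d ^+ 2 * enorm B u).
  rewrite -nabla3_swap// -lerBlDl (le_trans (hL [:: d; d; u] _ _ erefl))//.
  rewrite !big_cons big_nil mulr1 [enorm B d * (_ * _)]mulrA -expr2.
  rewrite ler_wpM2r ?mulr_ge0//.
  by rewrite ler_wpM2l.
(* Convexity enters here: with v = u / |u|, the form D^2 f(x - tau v)[d,d] is nonnegative and equals
   D^2 f(x)[d,d] - tau D^3 f(w)[v,d,d] for some w on the segment. Moving from w back to x costs one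
   Hölder term. *)
have cub : tau * nabla f [:: u; d; d] x <=
    (nabla f [:: d; d] x + L * tau `^ (1 + nu) * enorm B d ^+ 2) * enorm B u.
  have [->|un0] := eqVneq u 0; first by rewrite [nabla f _ x]linear0 enorm0 !mulr0.
  have nu1 : 0 < enorm B u by rewrite enorm_gt0.
  set v := (enorm B u)^-1 *: u.
  have nv : enorm B v = 1.
    by rewrite enormZ ger0_norm ?invr_ge0// mulVf// gt_eqF.
  have -> : nabla f [:: u; d; d] x = enorm B u * nabla f [:: v; d; d] x.
    by rewrite /= -{1}(enorm_normalize B_pd u) linearZ.
  rewrite mulrCA mulrC ler_pM2r//.
  have [s s01 Es] := nabla_MVT x (- tau *: v) f3 (hs := [:: d; d]) erefl.
  have := nabla2_ge0 f2 (x + - tau *: v) d f_convex.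
  set w := x + s *: (- tau *: v) in Es.
  have xw : enorm B (x - w) = s * tau.
    rewrite opprD addrA subrr sub0r scalerA enormN enormZ nv mulr1.
    by rewrite normrM normrN (gtr0_norm tau0) gtr0_norm//; case/andP: s01.
  have Ev y : nabla f [:: - tau *: v; d; d] y = - tau * nabla f [:: v; d; d] y.
    by rewrite /= linearZ.
  rewrite Ev in Es.
  have := hL [:: v; d; d] x w erefl.
  rewrite !big_cons big_nil nv mul1r mulr1 -expr2 xw.
  have := powR_scaled_le s01 (ltW tau0) (lexx _) nu0.
  move: Es; rewrite tauE; set A' : R := nabla f _ (x + _).
  set A : R := nabla f [:: d; d] x; set q : R := nabla f _ w.
  set p : R := nabla f _ x; set T := (s * tau) `^ nu; set T1 := tau `^ nu.
  move=> Es TT1 pq A'0.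
  have TL : L * T * enorm B d ^+ 2 <= L * T1 * enorm B d ^+ 2.
    by rewrite ler_wpM2r ?sqr_ge0// ler_wpM2l.
  have : tau * (p - q) <= tau * (L * T1 * enorm B d ^+ 2).
    by rewrite ler_pM2l// (le_trans pq).
  by rewrite mulrBr; lra.
(* The Hölder terms of [zx] and [cub] add up to 2 L tau^(1+nu) r^2 |u|, absorbed by lambda r^2 |u|;
   then [dg] applies, and g = tau lambda. *)
have key : tau * nabla f [:: d; d; u] z <= tau * (lam * enorm B d * enorm B u).
  have -> : tau * (lam * enorm B d * enorm B u) = g * enorm B d * enorm B u.
    by rewrite /tau; field; rewrite gt_eqF.
  rewrite (le_trans (ler_wpM2l (ltW tau0) zx))// mulrDr.
  apply: (le_trans (lerD cub (lexx _))).
  rewrite [X in _ + X](_ : _ = L * tau `^ (1 + nu) * enorm B d ^+ 2 * enorm B u); last first.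
    by rewrite tauE; ring.
  rewrite -mulrDl ler_wpM2r//; apply: (le_trans _ dg).
  rewrite -addrA lerD2l -mulrDl ler_wpM2r ?sqr_ge0//.
  have Lt0 : 0 <= L * tau `^ (1 + nu) by rewrite mulr_ge0// powR_ge0.
  by lra.
rewrite ler_pM2l// in key; case/andP: th01 => th0 th1.
apply: (le_trans (ler_wpM2l (ltW th0) key)).
by rewrite ler_piMl ?(ltW th1)// !mulr_ge0// ltW.
Qed.

End RegularizedStep.

(** * Minimizers of strongly convex quadratic models *)

Lemma first_order_ge0 (R : realFieldType) (a b : R) :
  (forall t : R, 0 < t <= 1 -> 0 <= t * a + t ^+ 2 * b) -> 0 <= a.
Proof.
move=> H; apply/ler_addgt0Pr => e e0.
have B0 : 0 < `|b| + 1 by rewrite ltr_wpDl.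
have eB : 0 < e / (`|b| + 1) by rewrite divr_gt0.
(* Dividing by t leaves 0 <= a + t b, and this t makes t |b| at most e. *)
pose t := Num.min 1 (e / (`|b| + 1)).
have t0 : 0 < t by rewrite lt_min ltr01.
have : 0 <= t * a + t ^+ 2 * b by apply: H; rewrite t0 ge_min lexx.
rewrite expr2 -mulrA -mulrDr pmulr_rge0// => ab.
have te : t * (`|b| + 1) <= e by rewrite -ler_pdivlMr// ge_min lexx orbT.
have := ler_wpM2l (ltW t0) (ler_norm b); lra.
Qed.

Section QuadraticModel.
Variables (R : realType) (E : normedVectType R) (B : 'Hom(E, 'Hom(E, R^o))).
Hypotheses (B_sa : self_adjoint B) (B_pd : positive_definite B).
Variable psi : E -> \bar R.
Hypothesis psi_pcc : proper_closed_convex psi.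

Lemma pcc_convex (p : R) (a b : E) (ra rb : R) : 0 <= p <= 1 ->
  psi a = ra%:E -> psi b = rb%:E ->
  (psi (p *: a + (1 - p) *: b)%R <= (p * ra + (1 - p) * rb)%:E)%E.
Proof.
move=> /andP[p0 p1] pa pb; have [_ _ _ cvx] := psi_pcc.
have Ha : (a, ra : R^o) \in epigraph psi by rewrite inE /epigraph/= pa.
have Hb : (b, rb : R^o) \in epigraph psi by rewrite inE /epigraph/= pb.
by have := cvx _ _ (Itv01 p0 p1) Ha Hb; rewrite inE.
Qed.

Lemma edom_fin_num y : edom psi y -> exists r : R, psi y = r%:E.
Proof.
have [noo _ _ _] := psi_pcc; rewrite /edom/= => py.
exists (fine (psi y)); rewrite fineK//.
by rewrite fin_numE noo lt_eqF.
Qed.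

Variables (x : E) (s : 'Hom(E, R^o)) (C : 'Hom(E, 'Hom(E, R^o))) (lam : R).
Hypotheses (C_sa : self_adjoint C) (lam0 : 0 < lam).
Hypothesis C_coercive : forall u, lam * enorm B u ^+ 2 <= C u u.

Let Q y : R := s (y - x) + 2^-1 * C (y - x) (y - x).

Let Q_line z w (t : R) :
  Q (z + t *: w) = Q z + t * (s w + C (z - x) w) + t ^+ 2 * (2^-1 * C w w).
Proof.
rewrite /Q [z + t *: w - x]addrAC; move: (z - x) => d.
have -> : s (d + t *: w) = s d + t * s w by rewrite linearD linearZ.
rewrite !(formDl, formDr, formZl, formZr) (C_sa w d); by field.
Qed.

(** The Newton model with the regularization term absorbed into the form C. *)
Definition quadratic_model y : \bar R :=
  ((s (y - x) + 2^-1 * C (y - x) (y - x))%:E + psi y)%E.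

Lemma argmin_edom z : is_argmin quadratic_model z -> edom psi z.
Proof.
have [noo [y0 y0dom] _ _] := psi_pcc => zmin.
have [r0 y0r] := edom_fin_num y0dom.
have := zmin y0; rewrite /quadratic_model y0r /edom/=.
have := noo z; case: (psi z) => [r| |]// _ _.
by rewrite ltry.
Qed.

(** Compare z with z + t (y - z): convexity of psi makes the increment at most t times the wanted
    quantity plus O(t^2), and t tends to 0. *)
Lemma argmin_subgradient z : is_argmin quadratic_model z ->
  subgradient psi z (- s - C (z - x)).
Proof.
move=> zmin y; have [rz zr] := edom_fin_num (argmin_edom zmin).
have [noo _ _ _] := psi_pcc.
have := noo y; case yr : (psi y) => [ry| |]// _; last by rewrite leey.
rewrite zr -EFinD lee_fin.
rewrite add_lfunE !opp_lfunE.
set w := y - z.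
suff : 0 <= s w + C (z - x) w + ry - rz by lra.
apply: (first_order_ge0 (b := 2^-1 * C w w)) => t /andP[t0 t1].
have t01 : 0 <= t <= 1 by rewrite ltW.
have := pcc_convex t01 yr zr.
have -> : t *: y + (1 - t) *: z = z + t *: w.
  by rewrite /w scalerBr scalerBl scale1r addrCA.
move=> pt; have := zmin (z + t *: w).
rewrite /quadratic_model -!/(Q _) => H.
have := le_trans H (leeD2l _ pt).
rewrite zr -!EFinD lee_fin Q_line; lra.
Qed.

Let Q_continuous : continuous Q.
Proof.
move=> y; apply: (@cvgD _ R^o _ (nbhs y)).
  apply: (@continuous_comp _ _ _ (fun y => y - x) s); last exact: lfun_continuous.
  exact: (@cvgB _ E _ (nbhs y) _ id (cst x) _ _ cvg_id (cvg_cst x)).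
apply: (@cvgMl_tmp _ _ (nbhs y)).
apply: (@continuous_comp _ _ _ (fun y => y - x) (fun u => C u u)).
  exact: (@cvgB _ E _ (nbhs y) _ id (cst x) _ _ cvg_id (cvg_cst x)).
exact: quadratic_continuous.
Qed.

Let Q_lower y : lam / 2 * enorm B (y - x) ^+ 2
    - dnorm B s * enorm B (y - x) <= Q y.
Proof.
have := dnorm_le B_sa B_pd s (- (y - x)); have := C_coercive (y - x).
rewrite linearN enormN /Q /=; set a := s _; lra.
Qed.

(** Minimizing (y, r) -> Q y + r over the epigraph replaces the lower semicontinuous psi by a
    continuous function on a closed set; the sublevel set K of x0 is compact. *)
Lemma argmin_exists x0 s0 : edom psi x0 -> subgradient psi x0 s0 ->
  exists z, is_argmin quadratic_model z.
Proof.
move=> x0dom sub0; have [r0 x0r] := edom_fin_num x0dom.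
have [noo _ epi_closed _] := psi_pcc.
pose M := Q x0 + r0.
pose F (z : E * R^o) : R := Q z.1 + z.2.
pose K := epigraph psi `&` [set z | F z <= M].
have Fc : continuous F.
  move=> z; apply: (@cvgD _ R^o _ (nbhs z)); last exact: cvg_snd.
  by apply: (@continuous_comp _ _ _ fst Q); [exact: cvg_fst|exact: Q_continuous].
have K_closed : closed K.
  apply: closedI => //.
  have /continuous_closedP Fcl := Fc.
  exact: (Fcl _ (@closed_le R M)).
(* The supporting affine function at x0 bounds psi from below, so coercivity of
   the quadratic part confines K to a bounded set. *)
have psi_lower y r : epigraph psi (y, r) -> r0 + s0 (y - x0) <= r.
  by rewrite /epigraph/= -lee_fin EFinD -x0r => /(le_trans (sub0 y)).
pose S := dnorm B s; pose S0 := dnorm B s0.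
have S_ge0 : 0 <= S by exact: dnorm_ge0.
have S0_ge0 : 0 <= S0 by exact: dnorm_ge0.
have s0_lower y : s0 (x - x0) - S0 * enorm B (y - x) <= s0 (y - x0).
  have -> : y - x0 = (y - x) + (x - x0) by rewrite addrA subrK.
  have := dnorm_le B_sa B_pd s0 (- (y - x)).
  by rewrite linearN enormN linearD /= -/S0; set a := s0 _; set b := s0 _; lra.
pose C1 := M - r0 - s0 (x - x0).
have nK z : K z -> lam / 2 * enorm B (z.1 - x) ^+ 2
    - (S + S0) * enorm B (z.1 - x) <= C1.
  case: z => y r [/= /psi_lower Hr]; rewrite /F/= => HF.
  by have := Q_lower y; have := s0_lower y; rewrite /C1 -/S; lra.
(* Past this radius the quadratic term wins; the + 1 gives n > 1, so that |C1| <= |C1| n. *)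
pose N := 2 * (S + S0 + `|C1|) / lam + 1.
have bK z : K z -> enorm B (z.1 - x) <= N.
  move/nK; set n := enorm B _ => Hn; rewrite leNgt; apply/negP => Nn.
  have n1 : 1 < n.
    rewrite (le_lt_trans _ Nn)// lerDr; apply: divr_ge0; last exact: ltW.
    by rewrite mulr_ge0// !addr_ge0.
  have : 2 * (S + S0 + `|C1|) < lam * n.
    rewrite -ltr_pdivrMl// mulrC (le_lt_trans _ Nn)// lerDl//.
  have := ler_norm C1; have := normr_ge0 C1; nra.
have [c c0 cn] := enorm_lower_bound B_pd.
pose rho := N / c + `|x|.
have rK z : K z -> `|z.1| <= rho.
  move=> /bK zN; rewrite -(subrK x z.1) (le_trans (ler_normD _ _))// lerD2r.
  by rewrite ler_pdivlMr// mulrC (le_trans (cn _)).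
(* The height is bounded below by the supporting function and above by r <= M - Q y <= M + S N. *)
pose l := r0 + s0 (x - x0) - S0 * N; pose u := M + S * N.
have lK z : K z -> l <= z.2 <= u.
  case: z => y r Kz; have /= nN := bK _ Kz; case: Kz => /psi_lower/= Hr.
  rewrite /F/= => HF.
  have q0 := sqr_ge0 (enorm B (y - x)).
  have := Q_lower y; have := s0_lower y.
  have := ler_wpM2l S_ge0 nN; have := ler_wpM2l S0_ge0 nN; rewrite -/S => *.
  have : 0 <= lam / 2 * enorm B (y - x) ^+ 2 by rewrite mulr_ge0// divr_ge0// ltW.
  by move=> ?; rewrite /l /u; apply/andP; split; lra.
have K_compact : compact K.
  have ball_compact : compact [set y : E | `|y| <= rho].
    apply: bounded_closed_compact_vect.
      by exists rho; split=> [|r rr y /= /le_trans]; [exact: num_real|apply; exact: ltW].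
    have /continuous_closedP ncl := @norm_continuous R E.
    exact: (ncl _ (@closed_le R rho)).
  apply: (subclosed_compact K_closed
    (compact_setX ball_compact (@segment_compact R l u))).
  by move=> z Kz; split; [exact: rK|rewrite /= in_itv/=; exact: lK].
have [|z /set_mem [zepi zM] zmin] :=
    compact_EVT_min (A := K) _ K_compact (continuous_subspaceT Fc).
  by exists (x0, r0 : R^o); split; rewrite /epigraph/= ?x0r// /F/=.
exists z.1 => y; rewrite /quadratic_model -!/(Q _).
have H1 : ((Q z.1)%:E + psi z.1 <= (F z)%:E)%E.
  by rewrite [(F z)%:E]EFinD; apply: leeD2l; exact: zepi.
apply: (le_trans H1); have := noo y; case yr : (psi y) => [ry| |]// _; last first.
  by rewrite addey// leey.
rewrite -EFinD lee_fin; have [yM|/ltW My] := leP (Q y + ry) M.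
  by apply: (zmin (y, ry)); rewrite inE; split => //; rewrite /epigraph/= yr.
exact: le_trans My.
Qed.

End QuadraticModel.

(** * The method *)

Section NewtonStep.
Variables (R : realType) (E : normedVectType R) (B : 'Hom(E, 'Hom(E, R^o))).
Variables (f : E -> R^o) (psi : E -> \bar R) (alpha : R).
Hypotheses (B_sa : self_adjoint B) (B_pd : positive_definite B).
Hypothesis f_convex : convex_function [set: convex_lmodType E] f.
Hypothesis f2 : ntimes_differentiable 2 f.
Hypothesis psi_pcc : proper_closed_convex psi.

Let hessian_linear x : linear (hessian f x).
Proof.
move=> a u v; apply/lfunP => w.
by rewrite add_lfunE scale_lfunE !hessianE//= linearP.
Qed.

Definition model_form (x : E) (lam : R) : 'Hom(E, 'Hom(E, R^o)) :=
  linfun (hessian f x) + lam *: B.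

Lemma model_formE x lam h : model_form x lam h = hessian f x h + lam *: B h.
Proof.
pose g : {linear E -> 'Hom(E, R^o)} := HB.pack (hessian f x)
  (GRing.isLinear.Build _ _ _ _ _ (hessian_linear x)).
by rewrite add_lfunE scale_lfunE (lfunE g).
Qed.

Lemma newton_modelE x lam : newton_model B f psi x lam =
  quadratic_model psi x (gradient f x) (model_form x lam).
Proof.
apply/funext => y; rewrite /newton_model /quadratic_model; congr (_%:E + _)%E.
rewrite model_formE add_lfunE scale_lfunE sqr_enorm//.
move: (gradient f x _) (hessian f x _ _) (B _ _) => a b c.
by rewrite /GRing.scale/=; field.
Qed.

Lemma model_form_sa x lam : self_adjoint (model_form x lam).
Proof.
move=> u v; rewrite !model_formE !add_lfunE !scale_lfunE !hessianE//.
by rewrite nabla2_sym// B_sa.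
Qed.

Lemma model_form_coercive x lam u :
  lam * enorm B u ^+ 2 <= model_form x lam u u.
Proof.
rewrite model_formE add_lfunE scale_lfunE hessianE// sqr_enorm//.
by rewrite lerDr nabla2_ge0.
Qed.

(** Invariant of the iterates: it supplies monotonicity of the subdifferential and existence of the
    next trial point. *)
Definition admissible (st : state E) : Prop :=
  edom psi (st_point st) /\ subgradient psi (st_point st) (st_subgrad st).

Lemma trial_exists st j : admissible st -> 0 < reg_coef B f alpha st j ->
  exists st', trial B f psi alpha st j st'.
Proof.
move=> [st_dom st_sub] lam0; set lam := reg_coef _ _ _ _ _ in lam0.
have [z zmin] := argmin_exists B_sa B_pd psi_pcc (st_point st)
  (gradient f (st_point st)) lam0 (model_form_coercive (st_point st) lam) st_dom st_sub.
exists (State z (- gradient f (st_point st) - hessian f (st_point st) (z - st_point st)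
  - lam *: B (z - st_point st)) (4 ^+ j * st_reg st / 4)).
by split=> //=; rewrite newton_modelE.
Qed.

Lemma trial_admissible st j st' : trial B f psi alpha st j st' -> admissible st'.
Proof.
case; rewrite newton_modelE => zmin sE _; split.
  exact: (argmin_edom psi_pcc zmin).
rewrite sE -addrA -opprD -model_formE.
exact: (argmin_subgradient psi_pcc (@model_form_sa _ _)).
Qed.

Section OneTrial.
Variables (st st' : state E) (j : nat).
Hypotheses (st_adm : admissible st) (tr : trial B f psi alpha st j st').

Let x := st_point st.
Let d := st_point st' - x.
Let lam := reg_coef B f alpha st j.
Let g := grad_norm B f st.

(** Adding the subgradient inequalities at x and x_+ gives <psi'(x_+) - psi'(x), d> >= 0; inserting
    the formula for psi'(x_+) bounds the left side by -<F'(x), d>. *)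
Lemma trial_dissipation :
  nabla f [:: d; d] x + lam * enorm B d ^+ 2 <= g * enorm B d.
Proof.
have [st_dom st_sub] := st_adm; have [st'_dom st'_sub] := trial_admissible tr.
have [r xr] := edom_fin_num psi_pcc st_dom.
have [r' xr'] := edom_fin_num psi_pcc st'_dom.
have := st_sub (st_point st'); have := st'_sub (st_point st).
rewrite xr xr' -!EFinD !lee_fin -opprB -/x -/d linearN /=.
have [_ -> _] := tr; rewrite -/x -/d -/lam.
rewrite !add_lfunE !opp_lfunE scale_lfunE hessianE// -sqr_enorm//.
have := dnorm_le B_sa B_pd (compgrad f st) (- d).
rewrite enormN linearN /= add_lfunE -/(grad_norm B f st) -/g -/x.
move: (gradient f x d) (st_subgrad st d) => a b.
rewrite /GRing.scale/=; lra.
Qed.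

Let err := gradient f (st_point st') - gradient f x - hessian f x d.

Let compgradE : compgrad f st' = err - lam *: B d.
Proof.
rewrite /compgrad; have [_ -> _] := tr; rewrite -/x -/d -/lam /err.
by rewrite !addrA.
Qed.

Lemma trial_accepted (q : R) : 0 < lam -> 0 < g -> 2 <= q <= 4 ->
  (smoothness_const B f q < +oo)%E -> (0 <= smoothness_const B f q)%E ->
  6 * (fine (smoothness_const B f q) * (g / lam) `^ (q - 2)) <= lam ->
  accepted B f alpha st j st'.
Proof.
move=> lam0 g0 /andP[q2 q4] M_fin M_ge0 thr.
have dE : st_point st - st_point st' = - d by rewrite opprB.
rewrite /accepted -/lam compgradE dE.
apply: (step_progress B_sa B_pd lam0); apply: dnorm_bound => //.
  by rewrite mulr_ge0 ?enorm_ge0// ltW.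
move=> u; rewrite /err !add_lfunE !opp_lfunE hessianE// !gradientE.
have -> : st_point st' = x + d by rewrite /d addrC subrK.
have M0 : 0 <= fine (smoothness_const B f q) by exact: fine_ge0.
(* The exponent q - 2 is nu when q < 3, and 1 + nu with nu = q - 3 from q = 3 on. *)
move: M_fin M_ge0 thr M0; rewrite /smoothness_const; case: ifP => q3.
  move=> M_fin M_ge0 thr M0.
  apply: (taylor_remainder_bound2 f_convex f2 lam0 g0 trial_dissipation
    (nu := q - 2) _ _ M0) => //.
  - by rewrite subr_ge0.
  - by move=> hs y z sz; exact: (holder_const_bound B_pd).
  - apply: le_trans thr; rewrite ler_peMl ?mulr_ge0 ?powR_ge0//.
    by lra.
move=> M_fin M_ge0 thr M0.
have f3 := holder_const_differentiable M_fin.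
apply: (taylor_remainder_bound3 B_pd f_convex f2 lam0 g0 trial_dissipation
    (nu := q - 3) _ _ M0) => //.
- by rewrite subr_ge0 leNgt q3.
- by move=> hs y z sz; exact: (holder_const_bound B_pd).
- by have -> : 1 + (q - 3) = q - 2 by ring.
Qed.

(** With g' the new gradient norm, acceptance and duality give g'^2 / (4 lambda) <= g' r, so g' <= 4
    lambda r <= 4 g. *)
Lemma accepted_grad_norm_le : 0 < lam -> 0 < g ->
  accepted B f alpha st j st' -> grad_norm B f st' <= 4 * g.
Proof.
move=> lam0 g0; rewrite /accepted -/lam -/(grad_norm B f st') => acc.
have rg := step_length f_convex f2 lam0 g0 trial_dissipation.
have := dnorm_le B_sa B_pd (compgrad f st') (st_point st - st_point st').
have dE : st_point st - st_point st' = - d by rewrite opprB.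
rewrite dE in acc *; rewrite enormN -/(grad_norm B f st') => cs.
have := le_trans acc cs; set g' := grad_norm B f st'.
have [->|g'n0] := eqVneq g' 0; first by rewrite mulr_ge0// ltW.
have g'0 : 0 < g' by rewrite lt_neqAle eq_sym g'n0 dnorm_ge0.
have lam4 : 0 < 4 * lam by exact: mulr_gt0.
rewrite expr2 mulrCA ler_pM2l// mulrC ler_pdivrMr// => H.
move: rg; rewrite ler_pdivlMr// => rg.
by apply: (le_trans H); lra.
Qed.

End OneTrial.

End NewtonStep.

(** * Estimates for the function H_alpha *)

Section HalphaBounds.
Variables (R : realType) (E : normedVectType R) (B : 'Hom(E, 'Hom(E, R^o))).
Variables (f : E -> R^o) (alpha : R).
Hypothesis B_pd : positive_definite B.
Hypothesis alpha_range : 2 / 3 <= alpha <= 1.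
Variable v : E.
Hypothesis vn0 : v != 0.

Lemma smoothness_const_ge0 q : (smoothness_const B f q < +oo)%E ->
  (0 <= smoothness_const B f q)%E.
Proof.
by rewrite /smoothness_const; case: ifP => _; exact: (holder_const_ge0 B_pd _ vn0).
Qed.

(** On [2,4] the fraction (q-2)/(q-1) stays between 0 and its value 2/3 at q = 4, which alpha >= 2/3
    dominates. *)
Lemma Halpha_exponent q : 2 <= q <= 4 -> 0 <= alpha - (q - 2) / (q - 1) <= 1.
Proof.
move=> /andP[q2 q4]; have q1 : 0 < q - 1 by lra.
have k0 : 0 <= (q - 2) / (q - 1) by apply: divr_ge0; lra.
have k1 : (q - 2) / (q - 1) <= 2 / 3 by rewrite ler_pdivrMr//; lra.
by case/andP: alpha_range => a1 a2; apply/andP; split; lra.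
Qed.

(** Multiply by g^alpha, raise to the power q - 1 to get L g^(q-2) <= lambda^(q-1), and divide by
    lambda^(q-2). *)
Lemma powR_threshold (H L g q : R) : 0 < H -> 0 <= L -> 0 < g -> 2 <= q <= 4 ->
  L `^ (q - 1)^-1 * g^-1 `^ (alpha - (q - 2) / (q - 1)) <= H ->
  L * (g / (H * g `^ alpha)) `^ (q - 2) <= H * g `^ alpha.
Proof.
move=> H0 L0 g0 /andP[q2 q4] HH; set lam := H * g `^ alpha.
have q1 : 0 < q - 1 by lra.
have lam0 : 0 < lam by rewrite mulr_gt0// powR_gt0.
have gD r s : g `^ (r + s) = g `^ r * g `^ s.
  by rewrite powRD// (gt_eqF g0) implybT.
have lower : L `^ (q - 1)^-1 * g `^ ((q - 2) / (q - 1)) <= lam.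
  have := ler_wpM2r (powR_ge0 g alpha) HH; rewrite -/lam -mulrA.
  rewrite -(powR_inv1 (ltW g0)) -powRrM -gD.
  by rewrite mulN1r opprB subrK.
have : (L `^ (q - 1)^-1 * g `^ ((q - 2) / (q - 1))) `^ (q - 1) <= lam `^ (q - 1).
  apply: ge0_ler_powR lower; rewrite ?nnegrE ?mulr_ge0 ?powR_ge0 ?ltW//.
rewrite powRM ?powR_ge0// -!powRrM mulVf ?gt_eqF// mulfVK ?gt_eqF// powRr1//.
have -> : q - 1 = 1 + (q - 2) by ring.
rewrite [lam `^ (1 + _)]powRD ?(gt_eqF lam0) ?implybT// powRr1 ?(ltW lam0)// => Lg.
have lq : 0 < lam `^ (q - 2) by rewrite powR_gt0.
have gl : 0 <= g / lam by rewrite divr_ge0// ltW.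
by rewrite -(ler_pM2r lq) -mulrA -powRM ?(ltW lam0)// divfK// gt_eqF.
Qed.

Lemma Halpha_lty t :
  (exists2 q : R, 2 <= q <= 4 & (smoothness_const B f q < +oo)%E) ->
  (Halpha B f alpha t < +oo)%E.
Proof.
case=> q q24 M_fin; apply: le_lt_trans (ereal_inf_lbound _) _; first by exists q.
have M0 := smoothness_const_ge0 M_fin.
rewrite -[smoothness_const B f q]fineK ?ge0_fin_numE//.
by rewrite -EFinM ltry.
Qed.

(** Strictness selects a q whose term is below H even if the infimum is not attained; an infinite
    M_q would make that term +oo. *)
Lemma Halpha_lt_threshold (t H : R) : 0 < t -> 0 < H ->
  (Halpha B f alpha t < H%:E)%E ->
  exists q, [/\ 2 <= q <= 4, (smoothness_const B f q < +oo)%E &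
    6 * (fine (smoothness_const B f q) * (t / (H * t `^ alpha)) `^ (q - 2))
      <= H * t `^ alpha].
Proof.
move=> t0 H0 /ereal_inf_lt[_ [q /= q24 <-]] qH; exists q.
have q1 : 0 < (q - 1)^-1 by rewrite invr_gt0; case/andP: q24; lra.
have M_fin : (smoothness_const B f q < +oo)%E.
  rewrite ltey; apply/eqP => Moo; move: qH; rewrite Moo mulry gtr0_sg// mul1e.
  by rewrite poweRyr ?gt_eqF// gt0_mulye ?lte_fin ?powR_gt0 ?invr_gt0.
have M0 := smoothness_const_ge0 M_fin.
split=> //; rewrite mulrA; apply: powR_threshold => //.
  by rewrite mulr_ge0// fine_ge0.
move: qH; rewrite -{1}[smoothness_const B f q]fineK ?ge0_fin_numE//.
by rewrite -EFinM lte_fin => /ltW.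
Qed.

(** Term by term: 1/t <= 4/t', and an exponent e in [0,1] turns the factor 4 into 4^e <= 4. *)
Lemma Halpha_quarter (t t' H : R) : 0 < t -> 0 < t' -> t' <= 4 * t ->
  (H%:E <= Halpha B f alpha t)%E -> ((H / 4)%:E <= Halpha B f alpha t')%E.
Proof.
move=> t0 t'0 tt' HH; apply/ereal_infP => _ [q /= q24 <-].
set P := poweR _ _; set e := alpha - _.
have P0 : (0 <= P)%E by exact: poweR_ge0.
have HP : (H%:E <= P * ((t^-1) `^ e)%:E)%E.
  by rewrite (le_trans HH)//; apply: ereal_inf_lbound; exists q.
have /andP[e0 e1] := Halpha_exponent q24.
have te : t^-1 `^ e / 4 <= t'^-1 `^ e.
  have : t^-1 `^ e <= (4 * t'^-1) `^ e.
    apply: (ge0_ler_powR e0); rewrite ?nnegrE.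
    - by rewrite invr_ge0 ltW.
    - by rewrite mulr_ge0// invr_ge0 ltW.
    - by rewrite ler_pdivlMr// mulrC ler_pdivrMr.
  rewrite powRM ?invr_ge0 ?(ltW t'0)// => Ht.
  have : 4 `^ e <= 4 :> R by rewrite -{2}(powRr1 (ler0n R 4)) ler_powR// ler1n.
  have := powR_ge0 t'^-1 e; nra.
rewrite EFinM (le_trans (lee_wpmul2r _ HP)) ?lee_fin//.
by rewrite -muleA -EFinM lee_wpmul2l// lee_fin.
Qed.

End HalphaBounds.

(** * Termination of the inner search and the invariant along the iterations *)

Section Method.
Variables (R : realType) (E : normedVectType R) (B : 'Hom(E, 'Hom(E, R^o))).
Variables (f : E -> R^o) (psi : E -> \bar R) (alpha : R).
Hypotheses (B_sa : self_adjoint B) (B_pd : positive_definite B).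
Hypothesis f_convex : convex_function [set: convex_lmodType E] f.
Hypothesis f2 : ntimes_differentiable 2 f.
Hypothesis psi_pcc : proper_closed_convex psi.
Hypothesis alpha_range : 2 / 3 <= alpha <= 1.
Hypothesis M_fin :
  exists2 q : R, 2 <= q <= 4 & (smoothness_const B f q < +oo)%E.

(** Supplies the nonzero vector that makes the finite M_q nonnegative. *)
Lemma grad_norm_gt0_nontrivial (st : state E) : 0 < grad_norm B f st ->
  exists v : E, v != 0.
Proof.
move=> g0; exists ((B^-1)%VF (compgrad f st)); rewrite -(enorm_gt0 B_pd).
by rewrite -dnormE.
Qed.

Section OneIteration.
Variable st : state E.
Hypotheses (st_adm : admissible psi st) (H_gt0 : 0 < st_reg st).
Hypothesis g_gt0 : 0 < grad_norm B f st.

Let pow4_gt0 j : 0 < 4 ^+ j * st_reg st.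
Proof. by rewrite mulr_gt0// exprn_gt0. Qed.

Lemma reg_coef_gt0 j : 0 < reg_coef B f alpha st j.
Proof. by rewrite /reg_coef mulr_gt0 ?powR_gt0. Qed.

Lemma large_reg_accepted j st' :
  (Halpha B f alpha (grad_norm B f st) < (4 ^+ j * st_reg st)%:E)%E ->
  trial B f psi alpha st j st' -> accepted B f alpha st j st'.
Proof.
have [v vn0] := grad_norm_gt0_nontrivial g_gt0.
move=> /(Halpha_lt_threshold B_pd vn0 g_gt0 (pow4_gt0 j)) [q [q24 Mq thr]] tr.
apply: (trial_accepted B_sa B_pd f_convex f2 psi_pcc st_adm tr _ g_gt0 q24 Mq) => //.
- exact: reg_coef_gt0.
- exact: smoothness_const_ge0 vn0 _ Mq.
Qed.

(** H_alpha(g) is finite because some M_q is, so 4^j H eventually exceeds it; the least accepted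
    index is then taken. *)
Lemma iteration_exists : exists j st', iteration B f psi alpha st j st'.
Proof.
pose ok j := `[< exists st', trial B f psi alpha st j st' /\
  accepted B f alpha st j st' >].
have ex_ok : exists j, ok j.
  have [v vn0] := grad_norm_gt0_nontrivial g_gt0.
  have Hfin := Halpha_lty alpha B_pd vn0 (grad_norm B f st) M_fin.
  have [j Hj] : exists j,
      (Halpha B f alpha (grad_norm B f st) < (4 ^+ j * st_reg st)%:E)%E.
    move: Hfin; case: (Halpha _ _ _ _) => [h| |]// _; last by exists 0%N; rewrite ltNyr.
    exists (Num.bound `|h / st_reg st|); rewrite lte_fin -ltr_pdivrMr//.
    apply: (le_lt_trans (ler_norm _)).
    apply: (lt_le_trans (archi_boundP (normr_ge0 _))).
    by rewrite -natrX ler_nat ltnW// ltn_expl.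
  have [st' tr] := trial_exists B_sa B_pd f_convex f2 psi_pcc st_adm (reg_coef_gt0 j).
  by exists j; apply/asboolP; exists st'; split => //; exact: large_reg_accepted.
case: (ex_minnP ex_ok) => j /asboolP[st' [tr acc]] jmin.
exists j, st'; split=> // i st'' ij tri acci.
have /jmin : ok i by apply/asboolP; exists st''.
by rewrite leqNgt ij.
Qed.

(** If j = 0 the new coefficient is H/4; otherwise it equals 4^(j-1) H, the coefficient of the last
    rejected trial. *)
Lemma iteration_reg_le j st' :
  ((st_reg st / 4)%:E <= Halpha B f alpha (grad_norm B f st))%E ->
  iteration B f psi alpha st j st' ->
  ((st_reg st')%:E <= Halpha B f alpha (grad_norm B f st))%E.
Proof.
move=> H4 [[_ _ ->] _ jmin]; case: j jmin => [|n] jmin.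
  by rewrite expr0 mul1r.
have -> : 4 ^+ n.+1 * st_reg st / 4 = 4 ^+ n * st_reg st.
  by rewrite exprS; field.
rewrite leNgt; apply/negP => large.
(* Rejection quantifies over trial points, so one must be exhibited for a contradiction. *)
have [st'' tr] := trial_exists B_sa B_pd f_convex f2 psi_pcc st_adm (reg_coef_gt0 n).
exact: (jmin n st'' (ltnSn n) tr (large_reg_accepted large tr)).
Qed.

End OneIteration.

Lemma iteration_grad_norm_le st j st' : admissible psi st ->
  0 < st_reg st -> 0 < grad_norm B f st -> iteration B f psi alpha st j st' ->
  grad_norm B f st' <= 4 * grad_norm B f st.
Proof.
move=> st_adm H0 g0 [tr acc _].
apply: (accepted_grad_norm_le B_sa B_pd f_convex f2 psi_pcc st_adm tr) => //.
exact: reg_coef_gt0.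
Qed.

Section Execution.
Variables (k : nat) (st : nat -> state E) (j : nat -> nat).
Hypothesis exec : sun_execution B f psi alpha k st j.
Hypothesis g_gt0 : forall i, (i < k)%N -> 0 < grad_norm B f (st i).
Hypotheses (st0_adm : admissible psi (st 0%N)) (H0_gt0 : 0 < st_reg (st 0%N)).
Hypothesis H0_le :
  ((st_reg (st 0%N))%:E <= Halpha B f alpha (grad_norm B f (st 0%N)))%E.

(** [sun_execution] constrains an iteration only if its inner search stops; termination discharges
    that condition. *)
Lemma execution_iteration i : (i < k)%N ->
  admissible psi (st i) -> 0 < st_reg (st i) ->
  iteration B f psi alpha (st i) (j i) (st i.+1).
Proof.
by move=> ik sti_adm H0; apply: exec => //; apply: iteration_exists => //; exact: g_gt0.
Qed.

(** The bound is on H_i / 4, since the factor 4 is what passing from g_{i-1} to g_i may cost. *)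
Lemma execution_invariant i : (i < k)%N ->
  [/\ admissible psi (st i), 0 < st_reg (st i) &
    ((st_reg (st i) / 4)%:E <= Halpha B f alpha (grad_norm B f (st i)))%E].
Proof.
elim: i => [k0|i IH ik].
  split=> //; apply: le_trans H0_le; rewrite lee_fin.
  by have := H0_gt0; set h := st_reg _; lra.
have {}ik' := ltnW ik; have [adm H0 H4] := IH ik'.
have it := execution_iteration ik' adm H0.
have [tr _ _] := it; split.
- exact: trial_admissible tr.
- by have [_ _ ->] := tr; rewrite divr_gt0// mulr_gt0// exprn_gt0.
- apply: (Halpha_quarter alpha_range (g_gt0 ik') (g_gt0 ik)).
    exact: (iteration_grad_norm_le adm H0 (g_gt0 ik') it).
  exact: (iteration_reg_le adm H0 (g_gt0 ik') H4 it).
Qed.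

(** Logarithm of H_i = H_0 4^(j_0 + ... + j_{i-1} - i), where the exponent is N_i - 2 i. *)
Lemma execution_reg i : (i <= k)%N -> 0 < st_reg (st i) /\
  ln (st_reg (st i)) = ln (st_reg (st 0%N))
    + ((oracle_calls j i)%:R - 2 * i%:R) * (2 * ln 2).
Proof.
have four0 : 0 < 4 :> R by [].
have ln4 : ln 4 = 2 * ln 2 :> R.
  by rewrite (_ : 4 = 2 ^+ 2 :> R) ?lnXn// -?natrX// mulr_natl.
elim: i => [_|i IH ik].
  by rewrite /oracle_calls big_geq// mulr0 subr0 mul0r addr0.
have [H0 lnH] := IH (ltnW ik).
have [adm _ _] := execution_invariant ik.
have [[_ _ ->] _ _] := execution_iteration ik adm H0.
have p0 : 0 < 4 ^+ j i :> R by rewrite exprn_gt0.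
split; first by rewrite divr_gt0// mulr_gt0.
rewrite ln_div ?posrE ?mulr_gt0// lnM ?posrE// lnXn// lnH ln4.
rewrite /oracle_calls big_nat_recr//= -/(oracle_calls j i) !natrD -addn1 natrD.
by rewrite -mulr_natl; ring.
Qed.

End Execution.

End Method.

(* MathComp-Analysis.  [fine] in the last bound is harmless: under the
   hypotheses the value of Halpha there is finite and positive. *)
Theorem lemma5 (R : realType) (E : normedVectType R)
    (B : 'Hom(E, 'Hom(E, R^o))) (f : E -> R^o) (psi : E -> \bar R)
    (alpha H0 : R) (x0 : E) (s0 : 'Hom(E, R^o))
    (k : nat) (st : nat -> state E) (j : nat -> nat)
    (B_sa : self_adjoint B) (B_pd : positive_definite B)
    (f_convex : convex_function [set: convex_lmodType E] f)
    (f_diff : ntimes_differentiable 2 f)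
    (psi_pcc : proper_closed_convex psi)
    (x0_dom : edom psi x0) (s0_sub : subgradient psi x0 s0)
    (alpha_range : 2 / 3 <= alpha <= 1) (H0_gt0 : 0 < H0)
    (M_fin : exists2 q : R, 2 <= q <= 4 & (smoothness_const B f q < +oo)%E)
    (H0_le : (H0%:E <= Halpha B f alpha (grad_norm B f (State x0 s0 H0)))%E)
    (k_ge1 : (1 <= k)%N)
    (st0 : st 0%N = State x0 s0 H0)
    (exec : sun_execution B f psi alpha k st j)
    (g_gt0 : forall i, (i < k)%N -> 0 < grad_norm B f (st i)) :
  [/\ forall i, (i < k)%N -> iteration B f psi alpha (st i) (j i) (st i.+1),
      forall i, (i < k)%N ->
        ((st_reg (st i.+1))%:E <= Halpha B f alpha (grad_norm B f (st i)))%E &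
      (oracle_calls j k)%:R <=
        2 * k%:R
        + 2^-1 * log2 (fine (Halpha B f alpha (grad_norm B f (st k.-1))) / H0)].
Proof.
have st0_adm : admissible psi (st 0%N) by rewrite st0.
have st0_gt0 : 0 < st_reg (st 0%N) by rewrite st0.
have st0_le :
  ((st_reg (st 0%N))%:E <= Halpha B f alpha (grad_norm B f (st 0%N)))%E.
  by rewrite st0.
have inv := execution_invariant B_sa B_pd f_convex f_diff psi_pcc alpha_range
  M_fin exec g_gt0 st0_adm st0_gt0 st0_le.
have it i : (i < k)%N -> iteration B f psi alpha (st i) (j i) (st i.+1).
  move=> ik; have [adm H _] := inv i ik.
  exact: (execution_iteration B_sa B_pd f_convex f_diff psi_pcc M_fin exec).
have reg i : (i < k)%N ->
    ((st_reg (st i.+1))%:E <= Halpha B f alpha (grad_norm B f (st i)))%E.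
  move=> ik; have [adm H H4] := inv i ik.
  exact: (iteration_reg_le B_sa B_pd f_convex f_diff psi_pcc adm H (g_gt0 i ik)
    H4 (it i ik)).
split=> //.
have [Hk0 lnHk] := execution_reg B_sa B_pd f_convex f_diff psi_pcc alpha_range
  M_fin exec g_gt0 st0_adm st0_gt0 st0_le (leqnn k).
have ik : (k.-1 < k)%N by rewrite prednK.
have := reg _ ik; rewrite prednK//.
have [v vn0] := grad_norm_gt0_nontrivial B_pd (g_gt0 _ ik).
have := Halpha_lty alpha B_pd vn0 (grad_norm B f (st k.-1)) M_fin.
(* The value +oo is excluded by finiteness of some M_q, and -oo by the lower bound H_k, so [fine]
   returns the actual value. *)
case: (Halpha _ _ _ _) => [h| |]//= _; rewrite lee_fin => Hkh.
have h0 : 0 < h by exact: lt_le_trans Hkh.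
have ln2 : 0 < ln 2 :> R by rewrite ln_gt0// ltr1n.
have lnle : ln (st_reg (st k)) <= ln h by rewrite ler_ln ?posrE.
rewrite /log2 ln_div ?posrE// -lerBlDl.
have -> : 2^-1 * ((ln h - ln H0) / ln 2) = (ln h - ln H0) / (2 * ln 2).
  by field; rewrite gt_eqF.
rewrite ler_pdivlMr ?mulr_gt0// lerBrDl.
by move: lnle; rewrite lnHk st0.
Qed.
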